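(* Let $(\Omega,\mathcal{A},\mathbb{P})$ be a probability space and $k\colon\Omega\times\mathbb{R}\times\mathbb{R}\to\mathbb{R}$ jointly measurable with $|k(\omega,s,t)|\le1$ almost surely, and suppose the mean kernel $K(s,t)=\mathbb{E}_\omega[k(\omega,s,t)]$ is continuous and positive definite ($k(\omega,\cdot,\cdot)$ need not be positive definite). Let $Z=\mathbb{R}^d\times\mathbb{R}\times\mathbb{R}$ and let $\rho$ be a Borel probability measure on $Z$. Let $f\colon\mathbb{R}^d\to\mathbb{R}$ have the representation $$f(x)=\int_Z c(a,b,t)K(\langle a,x\rangle+b,t)\,d\rho(a,b,t)$$ for some $c\in L^2(\rho)$ with $\|c\|_{L^2(\rho)}\le C$. Let $z_i=(a_i,b_i,t_i)$, $i=1,\dots,N$, be i.i.d. with law $\rho$ and $\omega_i$, $i=1,\dots,N$, i.i.d. with law $\mathbb{P}$, all mutually independent, and set $$F_N(x)=\frac1N\sum_{i=1}^N c(z_i)\,k(\omega_i,\langle a_i,x\rangle+b_i,t_i)$$ (using any fixed measurable representative of $c$). Then for every probability measure $\mu$ on $\mathbb{R}^d$, $$\mathbb{E}\|F_N-f\|^2_{L^2(\mu)}\le\frac{C^2}{N},\qquad \mathbb{P}\big(\|F_N-f\|_{L^2(\mu)}>\epsilon\big)\le\frac{C^2}{N\epsilon^2}\quad\text{for all }\epsilon>0.$$ *)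

(* Defs.v *)
From HB Require Import structures.
From mathcomp Require Import all_boot all_order all_algebra.
From mathcomp Require Import all_classical all_reals all_analysis.

Set Implicit Arguments.
Unset Strict Implicit.
Unset Printing Implicit Defensive.

Import Order.TTheory GRing.Theory Num.Theory numFieldNormedType.Exports.
Local Open Scope classical_set_scope.
Local Open Scope ring_scope.

(* Euclidean inner product <a, x> on R^d, with R^d represented as d.-tuple R
   (equipped by MathComp-Analysis with the product sigma-algebra, which is
   the Borel sigma-algebra of R^d). *)
Definition dotR (R : realType) (d : nat) (a x : d.-tuple R) : R :=
  \sum_(i < d) tnth a i * tnth x i.

Definition pd_kernel (R : realType) (K : R -> R -> R) : Prop :=
  (forall s t, K s t = K t s) /\
  (forall (n : nat) (x : 'I_n -> R) (a : 'I_n -> R),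
      0 <= \sum_(i < n) \sum_(j < n) a i * a j * K (x i) (x j)).

(* Mutual independence of the 2N random elements X_1..X_N, W_1..W_N defined on
   the probability space (S, Q): the joint law factorises on every family of
   measurable rectangles (taking full sets gives every finite subfamily). *)
Definition mutually_independent (R : realType)
  (dS : measure_display) (S : measurableType dS) (Q : probability S R)
  (dZ : measure_display) (Z : measurableType dZ)
  (dO : measure_display) (O : measurableType dO)
  (N : nat) (X : 'I_N -> S -> Z) (W : 'I_N -> S -> O) : Prop :=
  forall (A : 'I_N -> set Z) (B : 'I_N -> set O),
    (forall i, measurable (A i)) -> (forall i, measurable (B i)) ->
    Q ((\bigcap_(i in [set: 'I_N]) (X i @^-1` A i)) `&`
       (\bigcap_(i in [set: 'I_N]) (W i @^-1` B i)))
    = ((\prod_(i < N) Q (X i @^-1` A i)) * (\prod_(i < N) Q (W i @^-1` B i)))%E.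

(* Main.v *)
(** For fixed [x] the summands of [F_N x] are functions of the pairs
    [(z_i, omega_i)], which are pairwise independent with law [rho \x P]. By
    Fubini each summand has mean [f x], and since [|k| <= 1] its second moment
    is at most [C ^+ 2]; hence the mean square error at [x] is at most
    [C ^+ 2 / N]. Tonelli exchanges the integrals over the sample space and over
    [mu], and Markov's inequality for the squared error gives the tail bound. *)
Require Import Defs.
From HB Require Import structures.
From mathcomp Require Import all_boot all_order all_algebra.
From mathcomp Require Import all_classical all_reals all_analysis.
From mathcomp Require Import measurable_realfun ring lra.
Set Implicit Arguments.
Unset Strict Implicit.
Unset Printing Implicit Defensive.

Import Order.TTheory GRing.Theory Num.Theory numFieldNormedType.Exports.
Local Open Scope classical_set_scope.
Local Open Scope ring_scope.

(** * Product laws determined by measurable rectangles *)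

(* The event [E] allows the pi-system argument to be applied to one pair at a
   time in a family of four independent variables. *)
Lemma pair_law_on_event (R : realType) (dS d1 d2 : measure_display)
  (S : measurableType dS) (T1 : measurableType d1) (T2 : measurableType d2)
  (Q : probability S R) (m1 : probability T1 R) (m2 : probability T2 R)
  (X : S -> T1) (Y : S -> T2) (E : set S) :
  measurable_fun setT X -> measurable_fun setT Y -> measurable E ->
  (forall A B, measurable A -> measurable B ->
    Q ((X @^-1` A) `&` (Y @^-1` B) `&` E) = (m1 A * m2 B * Q E)%E) ->
  forall M, measurable M ->
    Q ((fun s => (X s, Y s)) @^-1` M `&` E) = ((m1 \x m2)%E M * Q E)%E.
Proof.
move=> mX mY mE rectE M mM.
have mXY : measurable_fun setT (fun s => (X s, Y s)).
  exact: measurable_fun_pair.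
have QEfin : Q E \is a fin_num by exact: fin_num_measure.
(* As functions of [M], both sides are measures: the image of [Q] restricted to [E], and the product
   measure scaled by the number [Q E]. They agree on the pi-system [C] of rectangles, which
   generates the product sigma-algebra, and have finite total mass. *)
pose q : {nonneg R} := NngNum (fine_ge0 (measure_ge0 Q E)).
pose C : set (set (T1 * T2)) := [set A1 `*` A2 | A1 in measurable & A2 in measurable].
pose G0 := [the {measure set (T1 * T2) -> \bar R} of
  pushforward (mrestr Q mE) (fun s => (X s, Y s))].
pose G := G0 mXY.
pose H := [the {measure set (T1 * T2) -> \bar R} of mscale q (m1 \x m2)%E].
have HE A : H A = ((m1 \x m2)%E A * Q E)%E.
  by rewrite /H /= /mscale /= fineK// muleC.
rewrite -HE -[LHS]/(G M); apply: (@measure_unique _ _ _ C (fun _ => setT) _ _ _ _ G H) => //.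
- by rewrite measurable_prod_measurableType.
- move=> _ _ [X1 mX1 [X2 mX2 <-]] [Y1 mY1 [Y2 mY2 <-]].
  exists (X1 `&` Y1); first exact: measurableI.
  by exists (X2 `&` Y2); [exact: measurableI|rewrite setXI].
- by move=> _; exists setT => //; exists setT => //; rewrite setXTT.
- by rewrite bigcup_const//; exists 0%N.
- move=> _ [A mA [B mB <-]].
  by rewrite HE product_measure1E// -rectE.
- move=> _; rewrite /G /G0 /= /pushforward /mrestr /= preimage_setT setTI.
  by rewrite ltey_eq QEfin.
Qed.

(** * Change of variables along a random element of given law *)

Lemma ge0_integral_law (R : realType) (dS dV : measure_display)
  (S : measurableType dS) (V : measurableType dV)
  (Q : probability S R) (nu : probability V R) (X : S -> V) (g : V -> \bar R) :
  measurable_fun setT X -> (forall A, measurable A -> Q (X @^-1` A) = nu A) ->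
  measurable_fun setT g -> (forall v, 0 <= g v)%E ->
  (\int[Q]_s g (X s) = \int[nu]_v g v)%E.
Proof.
move=> mX lawX mg g0.
have := @ge0_integral_pushforward _ _ _ _ _ _ mX Q setT g measurableT mg (fun v _ => g0 v).
rewrite preimage_setT => <-.
by apply: eq_measure_integral => A mA _; exact: lawX.
Qed.

Lemma integrable_law (R : realType) (dS dV : measure_display)
  (S : measurableType dS) (V : measurableType dV)
  (Q : probability S R) (nu : probability V R) (X : S -> V) (g : V -> \bar R) :
  measurable_fun setT X -> (forall A, measurable A -> Q (X @^-1` A) = nu A) ->
  nu.-integrable setT g -> Q.-integrable setT (g \o X).
Proof.
move=> mX lawX /integrableP[mg gfin]; apply/integrableP; split.
  exact: measurableT_comp.
rewrite (ge0_integral_law mX lawX (g := fun v => `|g v|)%E)//.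
exact: measurableT_comp.
Qed.

Lemma integral_law (R : realType) (dS dV : measure_display)
  (S : measurableType dS) (V : measurableType dV)
  (Q : probability S R) (nu : probability V R) (X : S -> V) (g : V -> \bar R) :
  measurable_fun setT X -> (forall A, measurable A -> Q (X @^-1` A) = nu A) ->
  nu.-integrable setT g -> (\int[Q]_s g (X s) = \int[nu]_v g v)%E.
Proof.
move=> mX lawX ig; have mg := measurable_int _ ig.
have := @integral_pushforward _ _ _ _ _ _ mX Q setT g mg.
rewrite preimage_setT => <-//; last exact: integrable_law ig.
by apply: eq_measure_integral => A mA _; exact: lawX.
Qed.

(** * Integrals with a parameter and integrals of products *)

(** Tonelli handles the positive and negative parts separately, and the integral is by definition
    their difference, so neither a sign nor integrability is required. This later yields the
    measurability of the target function from its integral formula. *)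
Lemma measurable_fun_integral_snd (R : realType) (d1 d2 : measure_display)
  (T1 : measurableType d1) (T2 : measurableType d2)
  (m2 : {sigma_finite_measure set T2 -> \bar R}) (f : T1 * T2 -> \bar R) :
  measurable_fun setT f -> measurable_fun setT (fun x => \int[m2]_y f (x, y))%E.
Proof.
move=> mf.
rewrite (_ : (fun x => _) =
  (fun x => \int[m2]_y f^\+ (x, y))%E \- (fun x => \int[m2]_y f^\- (x, y))%E)%E.
  apply: emeasurable_funB; apply: measurable_fun_fubini_tonelli_F => //.
    exact: measurable_funepos.
  exact: measurable_funeneg.
apply/funext => x; rewrite [LHS]integralE.
under eq_integral do rewrite funepos_comp/=.
by under [X in (_ - X)%E = _]eq_integral do rewrite funeneg_comp/=.
Qed.

Lemma integrable_prod_mul (R : realType) (d1 d2 : measure_display)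
  (T1 : measurableType d1) (T2 : measurableType d2)
  (m1 : probability T1 R) (m2 : probability T2 R) (h1 : T1 -> R) (h2 : T2 -> R) :
  m1.-integrable setT (EFin \o h1) -> m2.-integrable setT (EFin \o h2) ->
  (m1 \x m2)%E.-integrable setT (fun v => (h1 v.1 * h2 v.2)%:E).
Proof.
move=> ih1 ih2.
have mh1 : measurable_fun setT h1 by exact/measurable_EFinP/(measurable_int _ ih1).
have mh2 : measurable_fun setT h2 by exact/measurable_EFinP/(measurable_int _ ih2).
have mh : measurable_fun setT (fun v : T1 * T2 => (h1 v.1 * h2 v.2)%:E).
  apply/measurable_EFinP; apply: measurable_funM.
    exact: measurableT_comp.
  exact: measurableT_comp.
apply/integrable12ltyP => //=.
under eq_integral => x _.
  under eq_integral do rewrite normrM EFinM.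
  rewrite ge0_integralZl//; last by apply/measurable_EFinP; exact: measurableT_comp.
  over.
have /integrableP[_ f1] := ih1; have /integrableP[_ f2] := ih2.
rewrite /= in f1 f2.
rewrite ge0_integralZr//.
- by rewrite lte_mul_pinfty// ?integral_ge0// ge0_fin_numE// integral_ge0.
- by apply/measurable_EFinP; exact: measurableT_comp.
- exact: integral_ge0.
Qed.

Lemma integral_prod_mul (R : realType) (d1 d2 : measure_display)
  (T1 : measurableType d1) (T2 : measurableType d2)
  (m1 : probability T1 R) (m2 : probability T2 R) (h1 : T1 -> R) (h2 : T2 -> R) :
  m1.-integrable setT (EFin \o h1) -> m2.-integrable setT (EFin \o h2) ->
  (\int[m1 \x m2]_v (h1 v.1 * h2 v.2)%:E =
   \int[m1]_u (h1 u)%:E * \int[m2]_u (h2 u)%:E)%E.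
Proof.
move=> ih1 ih2.
rewrite -integral12_prod_meas1; last exact: integrable_prod_mul.
(* Finiteness turns the inner integral into a real scalar, which can be pulled out of the outer
   integral. *)
have fin2 : (\int[m2]_u (h2 u)%:E)%E \is a fin_num by exact: integrable_fin_num.
rewrite /fubini_F /=.
under eq_integral => x _.
  under eq_integral do rewrite EFinM.
  rewrite integralZl// -(fineK fin2).
  over.
by rewrite integralZr// fineK.
Qed.

(** * Mean square error of an average *)

(** The domination [|g| <= 1 + g ^+ 2] comes from [0 <= (|g| - 1) ^+ 2], and constants are
    integrable because the total mass is finite. *)
Lemma integrable_sqr_integrable (R : realType) (dV : measure_display)
  (V : measurableType dV) (nu : probability V R) (g : V -> R) :
  measurable_fun setT g -> nu.-integrable setT (fun v => (g v ^+ 2)%:E) ->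
  nu.-integrable setT (EFin \o g).
Proof.
move=> mg ig2.
apply: (@le_integrable _ _ _ _ _ measurableT _ (fun v => (1 + g v ^+ 2)%:E)).
- exact/measurable_EFinP.
- move=> v _ /=; rewrite lee_fin [leRHS]ger0_norm ?addr_ge0 ?sqr_ge0//.
  rewrite -(real_normK (num_real (g v))).
  by have := sqr_ge0 (`|g v| - 1); have := normr_ge0 (g v); nra.
- rewrite (_ : (fun v => _) = (cst 1%:E \+ (fun v => (g v ^+ 2)%:E))%E)//.
  by apply: integrableD => //; exact: finite_measure_integrable_cst.
Qed.

(* The variance of an average of [N] pairwise independent copies is [1/N] times
   the variance of one copy, hence at most [1/N] times its second moment. *)
Lemma mean_square_error_average (R : realType) (dS dV : measure_display)
  (S : measurableType dS) (V : measurableType dV)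
  (Q : probability S R) (nu : probability V R)
  (N : nat) (X : 'I_N -> S -> V) (g : V -> R) (m B : R) :
  (0 < N)%N ->
  (forall i, measurable_fun setT (X i)) ->
  (forall i A, measurable A -> Q (X i @^-1` A) = nu A) ->
  (forall i j, i != j -> forall M, measurable M ->
    Q ((fun s => (X i s, X j s)) @^-1` M) = (nu \x nu)%E M) ->
  measurable_fun setT g -> (\int[nu]_v (g v)%:E = m%:E)%E ->
  (\int[nu]_v (g v ^+ 2)%:E <= B%:E)%E ->
  (\int[Q]_s ((N%:R^-1 * (\sum_(i < N) g (X i s)) - m) ^+ 2)%:E <= (B / N%:R)%:E)%E.
Proof.
move=> N0 mX lawX indX mg mean_g mom_g.
have ig2 : nu.-integrable setT (fun v => (g v ^+ 2)%:E).
  apply/integrableP; split; first exact/measurable_EFinP/measurable_funX.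
  under eq_integral do rewrite /= ger0_norm ?sqr_ge0//.
  by rewrite (le_lt_trans mom_g)// ltry.
have ig := integrable_sqr_integrable mg ig2.
pose h v := g v - m.
have mh : measurable_fun setT h by exact: measurable_funB.
(* Integrating this expansion of the centred square gives the second moment of [g] minus [m ^+ 2],
   whence [mom_h]. *)
have h2E v : (h v ^+ 2)%:E = ((g v ^+ 2)%:E - ((2 * m)%:E * (g v)%:E - (m ^+ 2)%:E))%E.
  by rewrite -EFinM -!EFinB; congr EFin; rewrite /h; ring.
have igm : nu.-integrable setT (fun v => (2 * m)%:E * (g v)%:E - (m ^+ 2)%:E)%E.
  apply: integrableB => //; first exact: integrableZl.
  exact: finite_measure_integrable_cst.
have ih : nu.-integrable setT (EFin \o h).
  rewrite (_ : EFin \o h = ((EFin \o g) \- cst m%:E)%E)//.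
  by apply: integrableB => //; exact: finite_measure_integrable_cst.
have mean_h : (\int[nu]_v (h v)%:E = 0)%E.
  under eq_integral do rewrite /h EFinB.
  rewrite integralB//; last exact: finite_measure_integrable_cst.
  by rewrite mean_g integral_cst//= probability_setT mule1 subee.
have ih2 : nu.-integrable setT (fun v => (h v ^+ 2)%:E).
  by under eq_fun do rewrite h2E; exact: integrableB.
have mom_h : (\int[nu]_v (h v ^+ 2)%:E <= B%:E)%E.
  under eq_integral do rewrite h2E.
  rewrite integralB// integralB//; last 2 first.
  - exact: integrableZl.
  - exact: finite_measure_integrable_cst.
  rewrite integralZl// mean_g integral_cst//= probability_setT mule1.
  apply: le_trans mom_g.
  rewrite -EFinM -EFinB leeBlDr// leeDl// lee_fin.
  by have := sqr_ge0 m; nra.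
(* Entries of the expanded square: diagonal ones are integrable by the law of [X i], off-diagonal
   ones by the product law of the pair. *)
pose H i j s := (h (X i s) * h (X j s))%:E.
have iHd i : Q.-integrable setT (H i i).
  exact: (integrable_law (mX i) (lawX i) ih2).
have ihh := integrable_prod_mul ih ih.
have iHo i j : i != j -> Q.-integrable setT (H i j).
  move=> ij; apply: (integrable_law _ (indX i j ij) ihh).
  exact: measurable_fun_pair.
have iH i j : Q.-integrable setT (H i j).
  by have [->|/iHo] := eqVneq i j.
have sqE s : ((N%:R^-1 * (\sum_(i < N) g (X i s)) - m) ^+ 2)%:E =
    ((N%:R^-2)%:E * \sum_(i < N) \sum_(j < N) H i j s)%E.
  under [in RHS]eq_bigr do rewrite /H sumEFin.
  rewrite sumEFin -EFinM; congr EFin.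
  have -> : N%:R^-1 * (\sum_(i < N) g (X i s)) - m = N%:R^-1 * \sum_(i < N) h (X i s).
    rewrite /h sumrB mulrBr sumr_const card_ord -[m *+ N]mulr_natl mulKf//.
    by rewrite pnatr_eq0 -lt0n.
  rewrite exprMn exprVn; congr (_ * _).
  by rewrite expr2 mulr_suml; apply: eq_bigr => i _; rewrite mulr_sumr.
under eq_integral do rewrite sqE.
rewrite integralZl//; last by apply: integrable_sum => // i _; exact: integrable_sum.
rewrite integral_sum//; last by move=> i; exact: integrable_sum.
(* In row [i] only the diagonal entry survives: for [j != i] the integral factorises into two means
   of [h], which vanish. *)
have rowE i : (\int[Q]_s (\sum_(j < N) H i j s) = \int[nu]_v (h v ^+ 2)%:E)%E.
  rewrite integral_sum// (bigD1 i)//= big1 ?adde0.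
    exact: (integral_law (mX i) (lawX i) ih2).
  move=> j ji; rewrite eq_sym in ji.
  rewrite /H (integral_law (measurable_fun_pair (mX i) (mX j)) (indX i j ji) ihh).
  by rewrite integral_prod_mul// mean_h mul0e.
under eq_bigr do rewrite rowE.
have hfin : (\int[nu]_v (h v ^+ 2)%:E)%E \is a fin_num by exact: integrable_fin_num.
move: mom_h; rewrite -(fineK hfin) sumEFin -EFinM !lee_fin => mom_h.
rewrite sumr_const card_ord -[X in _ * X]mulr_natl mulrA.
(* The [N] equal rows cancel one of the two factors [N%:R^-1]. *)
rewrite (_ : N%:R ^- 2 * N%:R = N%:R^-1 :> R).
  by rewrite mulrC ler_wpM2r// invr_ge0.
by rewrite expr2 invfM -mulrA mulVf ?mulr1// pnatr_eq0 -lt0n.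
Qed.

(** * Squares of norms in the extended reals *)

Lemma poweR2 (R : realType) (x : \bar R) : (0 <= x)%E -> (x `^ 2 = x ^+ 2)%E.
Proof.
case: x => [r| |]//= r0; first by rewrite powR_mulrn.
by rewrite mulyy pnatr_eq0.
Qed.

(** The identity also covers the value [+oo], so it applies to the error at every sample point
    before its norm is known to be finite. *)
Lemma Lnorm2_sqr (R : realType) (dV : measure_display) (V : measurableType dV)
  (nu : {measure set V -> \bar R}) (g : V -> R) :
  ('N[nu]_2%:E[(fun v => (g v)%:E)] ^+ 2 = \int[nu]_v (g v ^+ 2)%:E)%E.
Proof.
rewrite -poweR2 ?Lnorm_ge0// poweR_Lnorm ?pnatr_eq0//.
by apply: eq_integral => v _; rewrite poweR2// abse_EFin -EFin_expe real_normK ?num_real.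
Qed.

Lemma lte_sqr_ge0 (R : realType) (a : R) (x : \bar R) : 0 <= a -> (0 <= x)%E ->
  (a%:E < x)%E = ((a ^+ 2)%:E < x ^+ 2)%E.
Proof.
move=> a0; case: x => [r| |]// r0.
  by rewrite -EFin_expe !lte_fin ltr_pXn2r ?nnegrE.
by rewrite expe2 mulyy !ltry.
Qed.

(** * Laws of one and of two sample pairs *)

(** Putting full sets at all indices other than [i] leaves a rectangle in [X i] and [W i];
    rectangles then determine the joint law. *)
Lemma mutually_independent_pair_law (R : realType)
  (dS dZ dO : measure_display) (S : measurableType dS)
  (Z : measurableType dZ) (O : measurableType dO)
  (Q : probability S R) (rho : probability Z R) (P : probability O R)
  (N : nat) (X : 'I_N -> S -> Z) (W : 'I_N -> S -> O) :
  (forall i, measurable_fun setT (X i)) -> (forall i, measurable_fun setT (W i)) ->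
  (forall i A, measurable A -> Q (X i @^-1` A) = rho A) ->
  (forall i B, measurable B -> Q (W i @^-1` B) = P B) ->
  mutually_independent Q X W ->
  forall i M, measurable M ->
    Q ((fun s => (X i s, W i s)) @^-1` M) = (rho \x P)%E M.
Proof.
move=> mX mW lawX lawW ind i M mM.
rewrite -[X in Q X]setIT -[RHS]mule1 -(probability_setT Q).
apply: pair_law_on_event => // A B mA mB.
rewrite setIT probability_setT mule1.
pose F (T : Type) (D : set T) (l : 'I_N) := if l == i then D else setT.
have mF d (T : measurableType d) (D : set T) l : measurable D -> measurable (F T D l).
  by rewrite /F; case: ifP.
have := ind (F Z A) (F O B) (fun l => mF _ _ _ l mA) (fun l => mF _ _ _ l mB).
rewrite (bigD1 i)//= big1 => [|l li]; last first.
  by rewrite /F (negbTE li) preimage_setT probability_setT.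
rewrite (bigD1 i)//= big1 => [|l li]; last first.
  by rewrite /F (negbTE li) preimage_setT probability_setT.
rewrite /F eqxx !mule1 lawX// lawW// => <-; congr (Q _).
apply/seteqP; split => s /=.
  by move=> [As Bs]; split=> l _ /=; case: eqP => // ->.
by move=> [/(_ i I) + /(_ i I)]; rewrite /= eqxx.
Qed.

(** Independence is given only for four-fold rectangles. Three uses of [pair_law_on_event] extend
    it: from [M] to products of sets of pairs, then from a set for pair [j] to a rectangle with [E]
    an event of pair [i], then from a set for pair [i] to a rectangle with [E] a rectangle event of
    pair [j]. *)
Lemma mutually_independent_pairs_law (R : realType)
  (dS dZ dO : measure_display) (S : measurableType dS)
  (Z : measurableType dZ) (O : measurableType dO)
  (Q : probability S R) (rho : probability Z R) (P : probability O R)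
  (N : nat) (X : 'I_N -> S -> Z) (W : 'I_N -> S -> O) :
  (forall i, measurable_fun setT (X i)) -> (forall i, measurable_fun setT (W i)) ->
  (forall i A, measurable A -> Q (X i @^-1` A) = rho A) ->
  (forall i B, measurable B -> Q (W i @^-1` B) = P B) ->
  mutually_independent Q X W ->
  forall i j, i != j -> forall M, measurable M ->
    Q ((fun s => ((X i s, W i s), (X j s, W j s))) @^-1` M) =
    ((rho \x P) \x (rho \x P))%E M.
Proof.
move=> mX mW lawX lawW ind i j ij M mM.
have mXW l : measurable_fun setT (fun s => (X l s, W l s)).
  exact: measurable_fun_pair.
have lawXW := mutually_independent_pair_law mX mW lawX lawW ind.
have mpre d (T : measurableType d) (h : S -> T) D :
    measurable_fun setT h -> measurable D -> measurable (h @^-1` D).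
  by move=> mh mD; rewrite -[_ @^-1` _]setTI; exact: mh.
have rect A B A' B' : measurable A -> measurable B ->
    measurable A' -> measurable B' ->
    (Q (X i @^-1` A `&` W i @^-1` B `&` (X j @^-1` A' `&` W j @^-1` B')) =
     rho A * P B * (rho A' * P B'))%E.
  move=> mA mB mA' mB'.
  pose F (T : Type) (D D' : set T) (l : 'I_N) :=
    if l == i then D else if l == j then D' else setT.
  have mF d (T : measurableType d) (D D' : set T) l :
      measurable D -> measurable D' -> measurable (F T D D' l).
    by rewrite /F; case: ifP => // _; case: ifP.
  have := ind (F Z A A') (F O B B') (fun l => mF _ _ _ _ l mA mA')
    (fun l => mF _ _ _ _ l mB mB').
  have ji : j != i by rewrite eq_sym.
  rewrite (bigD1 i)//= (bigD1 j)//= big1 => [|l /andP[li lj]]; last first.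
    by rewrite /F (negbTE li) (negbTE lj) preimage_setT probability_setT.
  rewrite (bigD1 i)//= (bigD1 j)//= big1 => [|l /andP[li lj]]; last first.
    by rewrite /F (negbTE li) (negbTE lj) preimage_setT probability_setT.
  rewrite /F !eqxx (negbTE ji) !mule1 !lawX// !lawW// muleACA => <-; congr (Q _).
  apply/seteqP; split => s /=.
    by move=> [[As Bs] [As' Bs']]; split=> l _ /=;
      case: eqP => [->//|_]; case: eqP => [->//|].
  move=> [hA hB]; move: (hA i I) (hA j I) (hB i I) (hB j I).
  by rewrite /= !eqxx (negbTE ji).
rewrite -[X in Q X]setIT -[RHS]mule1 -(probability_setT Q).
apply: (pair_law_on_event (mXW i) (mXW j)) => // A B mA mB.
rewrite setIT probability_setT mule1 setIC muleC /= -(lawXW i A mA).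
apply: pair_law_on_event => //; first exact: mpre.
move=> A' B' mA' mB'; rewrite setIC lawXW// [RHS]muleC.
have QE : Q (X j @^-1` A' `&` W j @^-1` B') = (rho A' * P B')%E.
  have := lawXW j (A' `*` B') (measurableX mA' mB').
  by rewrite product_measure1E// => <-.
rewrite -QE; apply: pair_law_on_event => //.
  by apply: measurableI; exact: mpre.
by move=> A0 B0 mA0 mB0; rewrite rect// QE.
Qed.

(** * Measurability and moments of a single summand *)

Lemma measurable_dotR (R : realType) (d : nat) (dT : measure_display)
  (T : measurableType dT) (a x : T -> d.-tuple R) :
  measurable_fun setT a -> measurable_fun setT x ->
  measurable_fun setT (fun u => dotR (a u) (x u)).
Proof.
move=> ma mx; apply: measurable_sum => i.
by apply: measurable_funM;
  exact: (measurableT_comp (measurable_tnth i)).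
Qed.

(** By Tonelli the variable [w] can be integrated first; for fixed [z] the integrand is at most
    [c z ^+ 2] for almost every [w], and [P] has mass one. *)
Lemma second_moment_mul_bounded (R : realType) (dZ dO : measure_display)
  (Z : measurableType dZ) (O : measurableType dO)
  (rho : probability Z R) (P : probability O R) (c : Z -> R) (u : Z * O -> R) :
  measurable_fun setT c -> measurable_fun setT u ->
  {ae P, forall w, forall z, `|u (z, w)| <= 1} ->
  (\int[rho \x P]_v ((c v.1 * u v) ^+ 2)%:E <= \int[rho]_z (c z ^+ 2)%:E)%E.
Proof.
move=> mc mu u1.
have mcu : measurable_fun setT (fun v => ((c v.1 * u v) ^+ 2)%:E).
  apply/measurable_EFinP; apply: measurable_funX; apply: measurable_funM => //.
  exact: measurableT_comp.
rewrite fubini_tonelli1//; last by move=> v; rewrite lee_fin sqr_ge0.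
apply: ge0_le_integral => //.
- by move=> z _; apply: integral_ge0 => w _; rewrite lee_fin sqr_ge0.
- apply: measurable_fun_fubini_tonelli_F => // v.
  by rewrite lee_fin sqr_ge0.
- exact/measurable_EFinP/measurable_funX.
- move=> z _; rewrite /fubini_F /=.
  have -> : (c z ^+ 2)%:E = (\int[P]_w (cst (c z ^+ 2)%:E w))%E.
    by rewrite integral_cst//= probability_setT mule1.
  apply: ae_ge0_le_integral => //.
  + by move=> w _; rewrite lee_fin sqr_ge0.
  + exact: (measurable_fun_pair2 z mcu).
  + by move=> w _; rewrite lee_fin sqr_ge0.
  + apply: filterS u1 => w /(_ z) u1 _.
    rewrite lee_fin exprMn ler_piMr ?sqr_ge0//.
    by rewrite -real_normK ?num_real// expr_le1.
Qed.

(** The second-moment bound makes the product integrable, so Fubini applies; then [c z] leaves the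
    inner integral, whose remaining factor has mean [U z]. *)
Lemma mean_mul_bounded (R : realType) (dZ dO : measure_display)
  (Z : measurableType dZ) (O : measurableType dO)
  (rho : probability Z R) (P : probability O R)
  (c U : Z -> R) (u : Z * O -> R) :
  measurable_fun setT c -> measurable_fun setT u ->
  {ae P, forall w, forall z, `|u (z, w)| <= 1} ->
  (\int[rho]_z (c z ^+ 2)%:E < +oo)%E ->
  (forall z, (U z)%:E = \int[P]_w (u (z, w))%:E)%E ->
  (\int[rho \x P]_v (c v.1 * u v)%:E = \int[rho]_z (c z * U z)%:E)%E.
Proof.
move=> mc mu u1 c2 UE.
have mcu : measurable_fun setT (fun v => c v.1 * u v).
  by apply: measurable_funM => //; exact: measurableT_comp.
have icu : (rho \x P)%E.-integrable setT (fun v => (c v.1 * u v)%:E).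
  apply: integrable_sqr_integrable => //.
  apply/integrableP; split; first exact/measurable_EFinP/measurable_funX.
  under eq_integral do rewrite abse_EFin ger0_norm ?sqr_ge0//.
  exact: le_lt_trans (second_moment_mul_bounded rho mc mu u1) c2.
rewrite -integral12_prod_meas1//; apply: eq_integral => z _.
rewrite /fubini_F /= EFinM UE -integralZl//.
(* Pulling out [c z] requires the section of [u] at [z] to be integrable, which holds since it is
   almost surely bounded by one. *)
have muz := measurable_fun_pair2 z mu.
apply/integrableP; split; first exact/measurable_EFinP.
have : (\int[P]_w (cst 1%:E w) < +oo :> \bar R)%E.
  by rewrite integral_cst//= probability_setT mule1 ltry.
apply: le_lt_trans; apply: ae_ge0_le_integral => //.
- by apply: measurableT_comp => //; exact/measurable_EFinP.
- by apply: filterS u1 => w /(_ z); rewrite /= lee_fin.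
Qed.

(** * Error at a fixed point, integration over [mu], and the tail bound *)

Theorem theorem9 (R : realType)
  (dO : measure_display) (Omega : measurableType dO) (P : probability Omega R)
  (k : Omega -> R -> R -> R)
  (hk_meas : measurable_fun [set: (Omega * (R * R))%type] (fun p => k p.1 p.2.1 p.2.2))
  (hk_bound : {ae P, forall w, forall s t, `|k w s t| <= 1})
  (K : R -> R -> R)
  (hK_mean : forall s t, (K s t)%:E = (\int[P]_w (k w s t)%:E)%E)
  (hK_cont : continuous (fun p : R * R => K p.1 p.2))
  (hK_pd : pd_kernel K)
  (d : nat) (rho : probability (d.-tuple R * (R * R))%type R)
  (c : (d.-tuple R * (R * R))%type -> R) (C : R)
  (hc_meas : measurable_fun [set: (d.-tuple R * (R * R))%type] c)
  (hc_L2 : ('N[rho]_2%:E[EFin \o c] <= C%:E)%E)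
  (f : d.-tuple R -> R)
  (hf : forall x, (f x)%:E =
          (\int[rho]_z (c z * K (dotR z.1 x + z.2.1) z.2.2)%:E)%E)
  (N : nat) (hN : (0 < N)%N)
  (dS : measure_display) (S : measurableType dS) (Q : probability S R)
  (Zs : 'I_N -> S -> (d.-tuple R * (R * R))%type) (Ws : 'I_N -> S -> Omega)
  (hZ_meas : forall i, measurable_fun [set: S] (Zs i))
  (hW_meas : forall i, measurable_fun [set: S] (Ws i))
  (hZ_law : forall i A, measurable A -> Q (Zs i @^-1` A) = rho A)
  (hW_law : forall i B, measurable B -> Q (Ws i @^-1` B) = P B)
  (hind : mutually_independent Q Zs Ws)
  (mu : probability (d.-tuple R) R) :
  let FN := fun (s : S) (x : d.-tuple R) =>
    N%:R^-1 * \sum_(i < N) c (Zs i s) *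
      k (Ws i s) (dotR (Zs i s).1 x + (Zs i s).2.1) (Zs i s).2.2 in
  let err := fun s : S => ('N[mu]_2%:E[(fun x => (FN s x - f x)%:E)])%E in
  ((\int[Q]_s (err s ^+ 2)) <= (C ^+ 2 / N%:R)%:E)%E /\
  (forall eps : R, 0 < eps ->
     (Q [set s | (eps%:E < err s)%E] <= (C ^+ 2 / (N%:R * eps ^+ 2))%:E)%E).
Proof.
move=> FN err.
pose Z : measurableType _ := (d.-tuple R * (R * R))%type.
pose V : measurableType _ := (Z * Omega)%type.
pose u (x : d.-tuple R) (v : V) := k v.2 (dotR v.1.1 x + v.1.2.1) v.1.2.2.
(* Measurability is needed jointly in the point and the sample: sections serve the moments at fixed
   [x], the joint form serves the exchange of integrals. *)
have mu_u : measurable_fun setT (fun p : d.-tuple R * V => u p.1 p.2).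
  have mz : measurable_fun setT (fun p : d.-tuple R * V => p.2.1).
    exact: measurableT_comp.
  have mz2 : measurable_fun setT (fun p : d.-tuple R * V => p.2.1.2).
    exact: measurableT_comp.
  apply: (measurableT_comp hk_meas
    (g := fun p : d.-tuple R * V => (p.2.2, (dotR p.2.1.1 p.1 + p.2.1.2.1, p.2.1.2.2)))).
  apply: measurable_fun_pair; first exact: measurableT_comp.
  apply: measurable_fun_pair; last exact: measurableT_comp.
  apply: measurable_funD; last exact: measurableT_comp.
  by apply: measurable_dotR => //; exact: measurableT_comp.
have mux x : measurable_fun setT (u x) := measurable_fun_pair2 x mu_u.
have u1 x : {ae P, forall w, forall z, `|u x (z, w)| <= 1}.
  by apply: filterS hk_bound => w kw z; exact: kw.
(* The norm bound may be squared because the norm is nonnegative. *)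
have c2 : (\int[rho]_z (c z ^+ 2)%:E <= (C ^+ 2)%:E)%E.
  by rewrite -Lnorm2_sqr EFin_expe !expe2; apply: lee_pmul => //; exact: Lnorm_ge0.
have mean_u x : (\int[rho \x P]_v (c v.1 * u x v)%:E = (f x)%:E)%E.
  rewrite hf; apply: mean_mul_bounded => //.
  by rewrite (le_lt_trans c2)// ltry.
have mom_u x : (\int[rho \x P]_v ((c v.1 * u x v) ^+ 2)%:E <= (C ^+ 2)%:E)%E.
  by apply: le_trans c2; exact: second_moment_mul_bounded.
have mcu : measurable_fun setT (fun p : d.-tuple R * V => c p.2.1 * u p.1 p.2).
  apply: measurable_funM => //; apply: (measurableT_comp hc_meas).
  exact: measurableT_comp.
have mf : measurable_fun setT f.
  apply/measurable_EFinP; rewrite (_ : EFin \o f =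
    fun x => (\int[rho \x P]_v (c v.1 * u x v)%:E)%E); last first.
    by apply/funext => x; rewrite mean_u.
  pose nu : probability V R := (rho \x P)%E.
  by have /measurable_EFinP/(measurable_fun_integral_snd nu) := mcu.
have mFN : measurable_fun setT (fun p : S * d.-tuple R => (FN p.1 p.2 - f p.2) ^+ 2).
  apply: measurable_funX; apply: measurable_funB; last exact: measurableT_comp.
  apply: measurable_funM => //; apply: measurable_sum => i.
  apply: (measurableT_comp mcu (g := fun p : S * d.-tuple R => (p.2, (Zs i p.1, Ws i p.1)))).
  apply: measurable_fun_pair => //.
  by apply: measurable_fun_pair; apply: measurableT_comp.
have err2 s : (err s ^+ 2 = \int[mu]_x ((FN s x - f x) ^+ 2)%:E)%E.
  exact: Lnorm2_sqr.
have merr2 : measurable_fun setT (fun s => err s ^+ 2)%E.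
  under eq_fun do rewrite err2.
  by apply: (measurable_fun_integral_snd mu (f := fun p : S * d.-tuple R =>
    ((FN p.1 p.2 - f p.2) ^+ 2)%:E)); exact/measurable_EFinP.
have mse : (\int[Q]_s (err s ^+ 2) <= (C ^+ 2 / N%:R)%:E)%E.
  under eq_integral do rewrite err2.
  rewrite (fubini_tonelli (fun p : S * d.-tuple R =>
    ((FN p.1 p.2 - f p.2) ^+ 2)%:E))/=; last 2 first.
  - exact/measurable_EFinP.
  - by move=> p; rewrite lee_fin sqr_ge0.
  (* Since [mu] has mass one, the bound is the integral of a constant, and it suffices to compare
     integrands at each [x]. *)
  have <- : (\int[mu]_x (cst (C ^+ 2 / N%:R)%:E x) = (C ^+ 2 / N%:R)%:E)%E.
    by rewrite integral_cst//= probability_setT mule1.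
  apply: ge0_le_integral => //.
  - by move=> x _; apply: integral_ge0 => s _; rewrite lee_fin sqr_ge0.
  - apply: (measurable_fun_fubini_tonelli_G (fun p : S * d.-tuple R =>
      ((FN p.1 p.2 - f p.2) ^+ 2)%:E)); first exact/measurable_EFinP.
    by move=> p; rewrite lee_fin sqr_ge0.
  - move=> x _; apply: (mean_square_error_average (nu := (rho \x P)%E)
      (X := fun i s => (Zs i s, Ws i s)) (g := fun v => c v.1 * u x v)) => //.
    + by move=> i; exact: measurable_fun_pair.
    + exact: mutually_independent_pair_law.
    + exact: mutually_independent_pairs_law.
    + exact: (measurable_fun_pair2 x mcu).
split=> // eps eps0.
have eps2 : 0 < eps ^+ 2 by rewrite exprn_gt0.
have err2_ge0 s : (0 <= err s ^+ 2)%E by rewrite expe_ge0// Lnorm_ge0.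
(* The tail event is rewritten for the squared error, whose expectation is already bounded. *)
have setE : [set s | (eps%:E < err s)%E] = [set s | ((eps ^+ 2)%:E < err s ^+ 2)%E].
  by apply/funext => s /=; rewrite lte_sqr_ge0// ?Lnorm_ge0// ltW.
have mlt : measurable [set s | ((eps ^+ 2)%:E < err s ^+ 2)%E].
  by rewrite -[X in measurable X]setTI; exact: emeasurable_fun_o_infty.
have mle : measurable (setT `&` [set s | ((eps ^+ 2)%:E <= `|err s ^+ 2|)%E]).
  by apply: emeasurable_fun_c_infty => //; exact: measurableT_comp.
(* Markov's inequality at level [eps ^+ 2], with the identity as the monotone function. *)
have := @le_integral_comp_abse _ _ _ Q setT measurableT (fun s => err s ^+ 2)%E
  (eps ^+ 2) id (@measurable_id _ _ _) (fun _ => id) (fun _ _ _ _ => id) merr2 eps2.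
under eq_integral do rewrite gee0_abs//.
move=> /le_trans /(_ mse) markov_err.
(* The event in Markov's inequality uses [<=], so it contains the strict tail event and monotonicity
   of [Q] suffices. *)
set E := setT `&` _ in mle markov_err.
rewrite setE; apply: (@le_trans _ _ (Q E)).
  apply: le_measure; rewrite ?inE// => s lt_s; split=> //=.
  by rewrite gee0_abs; [exact: ltW|exact: err2_ge0].
have qfin : Q E \is a fin_num by exact: fin_num_measure.
move: markov_err => /=.
rewrite -(fineK qfin) -EFinM !lee_fin => markov_err.
by rewrite invfM mulrA ler_pdivlMr// mulrC.
Qed.
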